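(* Let $\gamma=(g_{jk})\in M_n(A_\Theta^\infty)$ be a positive invertible matrix with self-adjoint entries $g_{jk}\in (A_\Theta^\infty)_{sa}$, and equip $\chi_\Theta=(A_\Theta^\infty)^n$ with the Riemannian metric $\langle\cdot,\cdot\rangle$ determined by $\langle\partial_j,\partial_k\rangle=g_{jk}$. Let $\mathfrak g:=i(A_\Theta^\infty)_{sa}\cap\ker(\tau)$, identified with the Lie algebra of inner *-derivations of $A_\Theta^\infty$ via $\tilde a\mapsto \operatorname{ad}_{\tilde a}$. Let $\tilde\nabla$ be Rosenberg's Levi-Civita connection determined by $\gamma$, and let $$\ker({}^*+\operatorname{Ad}_\gamma^{-1}):=\{\nu\in M_n(A_\Theta^\infty):\ \nu^*+\gamma^{-1}\nu\gamma=0\},$$ a real vector space. For $\mu\in\operatorname{Hom}_{\mathbb R}(\mathfrak g,\ker({}^*+\operatorname{Ad}_\gamma^{-1}))$, let $\tilde\nabla+\mu$ denote the connection given by $(\tilde\nabla+\mu)_{D}=\tilde\nabla_{D}$ for $D$ in the $\mathbb R$-span of $\partial_1,\dots,\partial_n$ and $(\tilde\nabla+\mu)_{\operatorname{ad}_{\tilde a}}=\tilde\nabla_{\operatorname{ad}_{\tilde a}}+\mu(\tilde a)$ for $\tilde a\in\mathfrak g$. Then the set of all connections on $\chi_\Theta$ that are torsion-free, real, and compatible with the metric $\gamma$ is exactly the affine space $$\tilde\nabla+\operatorname{Hom}_{\mathbb R}\bigl(\mathfrak g,\ker({}^*+\operatorname{Ad}_\gamma^{-1})\bigr),$$ and this affine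 space is nontrivial (i.e. $\operatorname{Hom}_{\mathbb R}(\mathfrak g,\ker({}^*+\operatorname{Ad}_\gamma^{-1}))\neq 0$).
   Context: Noncommutative torus: $\Theta$ is a real skew-symmetric $n\times n$ matrix and $A_\Theta$ is the universal C*-algebra generated by unitaries $u_1,\dots,u_n$ with $u_ju_k=e^{2\pi i\Theta_{jk}}u_ku_j$. $A_\Theta^\infty$ is the dense unital *-subalgebra of smooth vectors for the canonical $\mathbb T^n$-action, $\partial_1,\dots,\partial_n$ are the associated commuting partial derivatives ($\partial_j u_k=2\pi i\,\delta_{jk}u_k$), which are *-derivations of $A_\Theta^\infty$, $\tau$ is the unique $\mathbb T^n$-invariant tracial state, and $(A_\Theta^\infty)_{sa}$ is the set of self-adjoint elements. $\operatorname{ad}_a(b)=ab-ba$. Standing assumption: $\Theta$ is ''generically transcendental'', which is used in the following form: $A_\Theta$ is simple (so the center of $A_\Theta^\infty$ is $\mathbb C$), and the real Lie algebra $\mathcal D_\Theta$ of all *-derivations $A_\Theta^\infty\to A_\Theta^\infty$ (derivations $\delta$ with $\delta(b^* )=\delta(b)^*$) is the $\mathbb R$-linear span of $\partial_1,\dots,\partial_n$ and the inner *-derivations. The inner *-derivations are exactly the $\operatorname{ad}_{\tilde a}$ for a unique $\tilde a\in\mathfrak g=i(A_\Theta^\infty)_{sa}\cap\ker\tau$ (skew-adjoint elements of trace zero), and $\mathcal D_\Theta$ is the direct sum of the span of the $\partial_j$ and $\operatorname{ad}(\mathfrak g)$. For $X\in\mathcal D_\Theta$, $a\in A_\Theta^\infty$,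 write $X\cdot a=X(a)$. $\chi_\Theta=(A_\Theta^\infty)^n$ is the free left $A_\Theta^\infty$-module whose standard basis vectors are denoted $\partial_1,\dots,\partial_n$ as well. Left-module endomorphisms are identified with matrices: $\nu=(\nu_{jk})\in M_n(A_\Theta^\infty)$ corresponds to the endomorphism $\partial_j\mapsto\sum_k\nu_{jk}\partial_k$, i.e. to right multiplication of row vectors by $\nu$. Riemannian metric: the $A_\Theta^\infty$-valued inner product $\langle \sum_j a_j\partial_j,\sum_k b_k\partial_k\rangle=\sum_{j,k}a_jg_{jk}b_k^*$, for a positive invertible $(g_{jk})\in M_n(A_\Theta^\infty)$ with self-adjoint entries. Connection: an $\mathbb R$-bilinear map $\nabla:\mathcal D_\Theta\times\chi_\Theta\to\chi_\Theta$, $(X,Y)\mapsto\nabla_XY$, with $\nabla_X(aY)=(X\cdot a)Y+a\nabla_XY$ for all $a\in A_\Theta^\infty$, $Y\in\chi_\Theta$. A connection is: (1) compatible with the metric if $X\cdot\langle Y,Z\rangle=\langle\nabla_XY,Z\rangle+\langle Y,\nabla_XZ\rangle$ for all $X\in\mathcal D_\Theta$, $Y,Z\in\chi_\Theta$; (2) torsion-free if $\nabla_{\partial_j}\partial_k=\nabla_{\partial_k}\partial_j$ for all $j,k$; (3) real if $\langle\nabla_{\partial_j}\partial_k,\partial_l\rangle$ is self-adjoint for all $j,k,l$. Rosenberg's Levi-Civita connection $\tilde\nabla$ of the metric is the unique connection (its existence and uniqueness is a theorem of Rosenberg) satisfying (1), (2), (3) and also (4): $\tilde\nabla_{\operatorname{ad}_{\tilde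 a}}Y=\tilde aY$ for all $\tilde a\in\mathfrak g$, $Y\in\chi_\Theta$. It satisfies $\langle\tilde\nabla_{\partial_j}\partial_k,\partial_l\rangle=\tfrac12(\partial_jg_{kl}+\partial_kg_{jl}-\partial_lg_{jk})$. *)

(* Defs.v *)
From HB Require Import structures.
From mathcomp Require Import all_boot all_order all_algebra complex.
From mathcomp Require Import boolp classical_sets functions reals topology.
From mathcomp Require Import normedtype derive trigo.

Set Implicit Arguments.
Unset Strict Implicit.
Unset Printing Implicit Defensive.

Import Order.TTheory GRing.Theory Num.Theory numFieldNormedType.Exports.
Import ComplexField.Normc.

Local Open Scope classical_set_scope.
Local Open Scope ring_scope.
Local Open Scope complex_scope.

HB.mixin Record Algebra_isStar (R : realType) A of GRing.Algebra R[i] A := {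
  star : A -> A ;
  starK : involutive star ;
  starD : {morph star : a b / a + b} ;
  starZ : forall (c : R[i]) a, star (c *: a) = c^*%C *: star a ;
  starM : forall a b, star (a * b) = star b * star a }.

#[short(type="starAlgType")]
HB.structure Definition StarAlg (R : realType) :=
  { A of GRing.Algebra R[i] A & Algebra_isStar R A }.

HB.mixin Record StarAlg_isCStar (R : realType) A of StarAlg R A := {
  cnorm : A -> R ;
  cnormD : forall a b, cnorm (a + b) <= cnorm a + cnorm b ;
  cnormZ : forall (c : R[i]) a, cnorm (c *: a) = normc c * cnorm a ;
  cnorm_eq0 : forall a, cnorm a = 0 -> a = 0 ;
  cnormM : forall a b, cnorm (a * b) <= cnorm a * cnorm b ;
  cnorm_star : forall a, cnorm (star a * a) = cnorm a ^+ 2 ;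
  cnorm_complete : forall x : nat -> A,
    (forall e, 0 < e -> exists N, forall m n, (N <= m)%N -> (N <= n)%N ->
      cnorm (x m - x n) < e) ->
    exists l, forall e, 0 < e -> exists N, forall n, (N <= n)%N ->
      cnorm (x n - l) < e }.

(* Unital C*-algebras.  The norm is not a [Num.norm]: MathComp-Analysis has no
   join of rings and normed modules, so the topology lives on the type alias
   [realmod A] below. *)
#[short(type="cstarAlgType")]
HB.structure Definition CStarAlg (R : realType) :=
  { A of StarAlg R A & StarAlg_isCStar R A }.

Section StarTheory.
Variables (R : realType) (A : starAlgType R).
Implicit Types a b : A.

Lemma star0 : star (0 : A) = 0.
Proof. by apply: (@addrI _ (star (0 : A))); rewrite -starD !addr0. Qed.

Lemma starN a : star (- a) = - star a.
Proof. by apply: (@addrI _ (star a)); rewrite -starD !subrr star0. Qed.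

Lemma starB a b : star (a - b) = star a - star b.
Proof. by rewrite starD starN. Qed.

Lemma star1 : star (1 : A) = 1.
Proof. by rewrite -[LHS]mulr1 -[X in _ * X]starK -starM mulr1 starK. Qed.

End StarTheory.

Definition realmod (R : realType) (V : lmodType R[i]) : Type := V.

Section RealMod.
Variables (R : realType) (V : lmodType R[i]).

HB.instance Definition _ := GRing.Zmodule.on (realmod V).

Definition rscale (r : R) (v : realmod V) : realmod V := r%:C *: (v : V).

Fact rscaleA r s v : rscale r (rscale s v) = rscale (r * s) v.
Proof. by rewrite /rscale scalerA -rmorphM. Qed.

Fact rscale1 : left_id 1 rscale.
Proof. by move=> v; rewrite /rscale rmorph1 scale1r. Qed.

Fact rscaleDr : right_distributive rscale +%R.
Proof. by move=> r v w; rewrite /rscale scalerDr. Qed.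

Fact rscaleDl v : {morph rscale^~ v : r s / r + s}.
Proof. by move=> r s; rewrite /rscale rmorphD scalerDl. Qed.

HB.instance Definition _ := GRing.Zmodule_isLmodule.Build R (realmod V)
  rscaleA rscale1 rscaleDr rscaleDl.

End RealMod.

Section CStarNorm.
Variables (R : realType) (A : cstarAlgType R).

Fact cnormZr (r : R) (a : realmod A) : cnorm (r *: a : A) = `|r| * cnorm (a : A).
Proof.
by rewrite [r *: a]/(r%:C *: (a : A)) cnormZ /= expr0n/= addr0 sqrtr_sqr.
Qed.

HB.instance Definition _ := Lmodule_isNormed.Build R (realmod A)
  (@cnormD R A) cnormZr (@cnorm_eq0 R A).

End CStarNorm.

Section CStarTopology.
Variables (R : realType) (A : cstarAlgType R).
Implicit Types a b : A.

Lemma cnormE a : `|a : realmod A| = cnorm a. Proof. by []. Qed.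

Lemma cnorm_ge0 a : 0 <= cnorm a.
Proof. by rewrite -cnormE. Qed.

Lemma cnormC_star a : cnorm (star a) = cnorm a.
Proof.
suff H b : cnorm b <= cnorm (star b).
  by apply/eqP; rewrite eq_le H -{2}[a]starK H.
have [->|b0] := eqVneq (cnorm b) 0; first exact: cnorm_ge0.
have {}b0 : 0 < cnorm b by rewrite lt_neqAle eq_sym b0 cnorm_ge0.
by rewrite -(ler_pM2r b0) -expr2 -cnorm_star cnormM.
Qed.

Section Cvg.
Context {T : Type} {F : set_system T} {FF : Filter F}.
Implicit Types f g : T -> realmod A.

Lemma cvg_cnorm_le f (l : realmod A) (h : T -> R) :
  (forall x, cnorm (f x - l : A) <= h x) -> h @ F --> 0 -> f @ F --> l.
Proof.
move=> fh h0.
have fl : (fun x => cnorm (f x - l : A)) @ F --> (0 : R).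
  apply: (@squeeze_cvgr _ _ _ _ (fun=> 0) h) => //; last exact: cvg_cst.
  by apply: nearW => x; rewrite cnorm_ge0 fh.
apply/subr_cvg0; apply: norm_cvg0; exact: fl.
Qed.

Lemma cvg_cnormB f (l : realmod A) :
  f @ F --> l -> (fun x => cnorm (f x - l : A)) @ F --> 0.
Proof. by move=> /subr_cvg0/norm_cvg0P. Qed.

Lemma cvg_cmul f g a b : f @ F --> (a : realmod A) -> g @ F --> (b : realmod A) ->
  (fun x => (f x : A) * (g x : A) : realmod A) @ F --> (a * b : realmod A).
Proof.
move=> fa gb.
pose h x : R := cnorm (f x - a : A) * cnorm (g x : A) +
  cnorm a * cnorm (g x - b : A).
apply: (cvg_cnorm_le (h := h)) => [x|].
  rewrite -[X in X - _](subrK (a * (g x : A))) -addrA -mulrBl -mulrBr.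
  by rewrite (le_trans (cnormD _ _))// lerD// cnormM.
rewrite -[X in _ --> X]addr0 -[X in _ --> X + _](mul0r (cnorm b)).
rewrite -[X in _ --> _ + X](mulr0 (cnorm a)).
apply: cvgD; apply: cvgM.
- exact: cvg_cnormB.
- exact: (cvg_norm gb).
- exact: cvg_cst.
- exact: cvg_cnormB.
Qed.

Lemma cvg_cscale (c : R[i]) f a : f @ F --> (a : realmod A) ->
  (fun x => c *: (f x : A) : realmod A) @ F --> (c *: a : realmod A).
Proof.
move=> fa; apply: (cvg_cnorm_le (h := fun x => normc c * cnorm (f x - a : A))).
  by move=> x; rewrite -[leLHS]/(cnorm (c *: (f x : A) - c *: a)) -scalerBr cnormZ.
rewrite -[X in _ --> X](mulr0 (normc c)).
by apply: cvgM; [exact: cvg_cst|exact: cvg_cnormB].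
Qed.

Lemma cvg_star f a : f @ F --> (a : realmod A) ->
  (fun x => star (f x : A) : realmod A) @ F --> (star a : realmod A).
Proof.
move=> fa; apply: (cvg_cnorm_le (h := fun x => cnorm (f x - a : A))).
  by move=> x; rewrite -[leLHS]/(cnorm (star (f x : A) - star a)) -starB cnormC_star.
exact: cvg_cnormB.
Qed.

End Cvg.
End CStarTopology.

Fixpoint Ck (R : realType) (W : normedModType R) n (k : nat)
    (f : 'rV[R]_n -> W) : Prop :=
  continuous f /\
  if k is k'.+1 then forall j : 'I_n,
    (forall t, derivable f t (delta_mx 0 j)) /\ Ck k' ('D_(delta_mx 0 j) f)
  else True.

Definition Cinfty (R : realType) (W : normedModType R) n (f : 'rV[R]_n -> W) :=
  forall k, Ck k f.

Section CkTheory.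
Variables (R : realType) (n : nat) (A : cstarAlgType R).
Implicit Types (f g : 'rV[R]_n -> realmod A) (t v : 'rV[R]_n).

Lemma Ck_continuous k f : Ck k f -> continuous f.
Proof. by case: k => [|k] []. Qed.

Lemma CkW k f : Ck k.+1 f -> Ck k f.
Proof.
elim: k f => [|k IH] f [cf fk]; split => // j.
by have [df dfk] := fk j; split => //; exact: IH.
Qed.

Lemma derivable_quot f t v : derivable f t v ->
  (fun h : R => h^-1 *: (f (h *: v + t) - f t)) @ 0^' --> 'D_v f t.
Proof. by []. Qed.

Lemma is_deriveP (q : R -> realmod A) f t v d :
  (forall h, q h = h^-1 *: (f (h *: v + t) - f t)) -> q @ 0^' --> d ->
  derivable f t v /\ 'D_v f t = d.
Proof.
move=> /funext -> fd; split; [exact: cvgP fd|exact/cvg_lim].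
Qed.

Lemma derivable_line f t v : derivable f t v ->
  (fun h : R => f (h *: v + t)) @ 0^' --> f t.
Proof.
move=> /derivable_quot fd; apply/subr_cvg0.
have id0 : (fun h : R => h) @ 0^' --> (0 : R).
  by exact: cvg_within.
have H : (fun h : R => h *: (h^-1 *: (f (h *: v + t) - f t))) @ 0^' -->
    (0 : realmod A).
  by rewrite -[X in _ --> X](scale0r ('D_v f t)); exact: cvgZ.
apply: (cvg_trans _ H); apply: near_eq_cvg.
near=> h; rewrite scalerA mulfV ?scale1r//.
by near: h; exact: nbhs_dnbhs_neq.
Unshelve. all: by end_near. Qed.

Lemma derive_cmul f g t v : derivable f t v -> derivable g t v ->
  derivable (fun x => (f x : A) * (g x : A) : realmod A) t v /\
  'D_v (fun x => (f x : A) * (g x : A) : realmod A) t =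
    ('D_v f t : A) * (g t : A) + (f t : A) * ('D_v g t : A).
Proof.
move=> df dg.
have fq := derivable_quot df; have gq := derivable_quot dg.
have gl := derivable_line dg.
apply: (is_deriveP _ (cvgD (cvg_cmul fq gl) (cvg_cmul (cvg_cst (f t)) gq))).
move=> h /=; rewrite -[LHS]/(_ * _ + _ * (_ *: _)).
rewrite -scalerAl -scalerAr -scalerDr.
congr (_ *: _); by rewrite mulrBl mulrBr addrA subrK.
Qed.

Lemma derive_cscale (c : R[i]) f t v : derivable f t v ->
  derivable (fun x => c *: (f x : A) : realmod A) t v /\
  'D_v (fun x => c *: (f x : A) : realmod A) t = c *: ('D_v f t : A).
Proof.
move=> /derivable_quot fq; apply: is_deriveP; last exact: (cvg_cscale (c := c) fq).
move=> h /=.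
by rewrite [LHS]scalerA mulrC -scalerA scalerBr.
Qed.

Lemma derive_star f t v : derivable f t v ->
  derivable (fun x => star (f x : A) : realmod A) t v /\
  'D_v (fun x => star (f x : A) : realmod A) t = star ('D_v f t : A).
Proof.
move=> /derivable_quot fq; apply: is_deriveP; last exact: (cvg_star fq).
move=> h /=.
by rewrite [LHS]starZ conjc_real starB.
Qed.

Lemma Ck_add k f g : Ck k f -> Ck k g -> Ck k (f \+ g).
Proof.
elim: k f g => [|k IH] f g [cf fk] [cg gk]; split => //.
- by move=> t; exact: cvgD (cf t) (cg t).
- by move=> t; exact: cvgD (cf t) (cg t).
move=> j; have [df dfk] := fk j; have [dg dgk] := gk j; split.
  by move=> t; exact: derivableD.
rewrite (_ : 'D__ _ = 'D_(delta_mx 0 j) f \+ 'D_(delta_mx 0 j) g); last first.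
  by apply/funext => t; exact: deriveD.
exact: IH.
Qed.

Lemma Ck_mul k f g : Ck k f -> Ck k g ->
  Ck k (fun x => (f x : A) * (g x : A) : realmod A).
Proof.
elim: k f g => [|k IH] f g fk gk.
  by split => // t; exact: cvg_cmul (@Ck_continuous _ _ fk t) (@Ck_continuous _ _ gk t).
have [cf fk'] := fk; have [cg gk'] := gk; split.
  by move=> t; exact: cvg_cmul (cf t) (cg t).
move=> j; have [df dfk] := fk' j; have [dg dgk] := gk' j; split.
  by move=> t; exact: (derive_cmul (df t) (dg t)).1.
set d := 'D__ _.
have -> : d = (fun x => (('D_(delta_mx 0 j) f x : A) * (g x : A)) : realmod A) \+
    (fun x => ((f x : A) * ('D_(delta_mx 0 j) g x : A)) : realmod A).
  by apply/funext => t; exact: (derive_cmul (df t) (dg t)).2.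
by apply: Ck_add; apply: IH => //; exact: CkW.
Qed.

Lemma Ck_scale k (c : R[i]) f : Ck k f ->
  Ck k (fun x => c *: (f x : A) : realmod A).
Proof.
elim: k f => [|k IH] f [cf fk]; split => //.
- by move=> t; exact: cvg_cscale (cf t).
- by move=> t; exact: cvg_cscale (cf t).
move=> j; have [df dfk] := fk j; split.
  by move=> t; exact: (derive_cscale c (df t)).1.
set d := 'D__ _.
have -> : d = fun x => c *: ('D_(delta_mx 0 j) f x : A) : realmod A.
  by apply/funext => t; exact: (derive_cscale c (df t)).2.
exact: IH.
Qed.

Lemma Ck_star k f : Ck k f -> Ck k (fun x => star (f x : A) : realmod A).
Proof.
elim: k f => [|k IH] f [cf fk]; split => //.
- by move=> t; exact: cvg_star (cf t).
- by move=> t; exact: cvg_star (cf t).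
move=> j; have [df dfk] := fk j; split.
  by move=> t; exact: (derive_star (df t)).1.
set d := 'D__ _.
have -> : d = fun x => star ('D_(delta_mx 0 j) f x : A) : realmod A.
  by apply/funext => t; exact: (derive_star (df t)).2.
exact: IH.
Qed.

Lemma Ck_cst k (a : realmod A) : Ck k (fun _ : 'rV[R]_n => a).
Proof.
elim: k a => [|k IH] a; split => //; try exact: cst_continuous.
move=> j; split => [t|]; first exact: derivable_cst.
rewrite (_ : 'D__ _ = fun=> 0); first exact: IH.
by apply/funext => t; exact: derive_cst.
Qed.

End CkTheory.

Definition expi (R : realType) (x : R) : R[i] :=
  cos (2 * pi * x) +i* sin (2 * pi * x).

Lemma expiD (R : realType) (x y : R) : expi (x + y) = expi x * expi y.
Proof.
rewrite /expi mulrDr cosD sinD.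
by apply/eqP; rewrite eq_complex /= eqxx [eqbRHS]addrC eqxx.
Qed.

Lemma expi0 (R : realType) : expi 0 = 1 :> R[i].
Proof. by rewrite /expi mulr0 cos0 sin0. Qed.

Lemma expi_conj (R : realType) (x : R) : (expi x)^* = expi (- x).
Proof. by rewrite /expi mulrN cosN sinN. Qed.

Lemma expiNl (R : realType) (x : R) : expi (- x) * expi x = 1.
Proof. by rewrite -expiD addNr expi0. Qed.

(* Unital *-homomorphisms.  Continuity is automatic for C*-algebras. *)
Record is_starhom (R : realType) (A B : cstarAlgType R) (phi : A -> B) : Prop := {
  starhom_linear : linear phi ;
  starhomM : {morph phi : a b / a * b} ;
  starhom1 : phi 1 = 1 ;
  starhom_star : {morph phi : a / star a} ;
  starhom_continuous : continuous (phi : realmod A -> realmod B) }.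

Section StarHomTheory.
Variables (R : realType) (A B : cstarAlgType R) (phi : A -> B).
Hypothesis h : is_starhom phi.

Lemma starhomD a b : phi (a + b) = phi a + phi b.
Proof. by have := starhom_linear h 1 a b; rewrite !scale1r. Qed.

Lemma starhom0 : phi 0 = 0.
Proof. by apply: (@addrI _ (phi 0)); rewrite -starhomD !addr0. Qed.

Lemma starhomZ c a : phi (c *: a) = c *: phi a.
Proof. by rewrite -[c *: a]addr0 (starhom_linear h) starhom0 addr0. Qed.

Lemma starhomB a b : phi (a - b) = phi a - phi b.
Proof. by rewrite -scaleN1r starhomD starhomZ scaleN1r. Qed.

End StarHomTheory.

Definition torus_relations (R : realType) n (Theta : 'M[R]_n)
    (A : cstarAlgType R) (u : 'I_n -> A) : Prop :=
  (forall j, star (u j) * u j = 1 /\ u j * star (u j) = 1) /\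
  (forall j k, u j * u k = expi (Theta j k) *: (u k * u j)).

(* The universal property determines A_Theta with its generators up to a unique
   isomorphism. *)
Record nctorus (R : realType) n (Theta : 'M[R]_n) := NCTorus {
  nct_algebra :> cstarAlgType R ;
  nct_gen : 'I_n -> nct_algebra ;
  nct_rel : torus_relations Theta nct_gen ;
  nct_universal : forall (B : cstarAlgType R) (v : 'I_n -> B),
    torus_relations Theta v ->
    exists! phi : nct_algebra -> B,
      is_starhom phi /\ forall j, phi (nct_gen j) = v j }.

Section Gauge.
Variables (R : realType) (n : nat) (Theta : 'M[R]_n) (A : nctorus Theta).
Implicit Types (t : 'rV[R]_n) (a b : A).

Lemma starhom_id : is_starhom (@id A).
Proof. by split=> //; move=> x; exact: cvg_id. Qed.

Lemma starhom_comp (B C D : cstarAlgType R) (phi : C -> D) (psi : B -> C) :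
  is_starhom phi -> is_starhom psi -> is_starhom (phi \o psi).
Proof.
move=> [l m o s c] [l' m' o' s' c']; split => /=.
- by move=> x a b /=; rewrite l' l.
- by move=> a b /=; rewrite m' m.
- by rewrite o' o.
- by move=> a /=; rewrite s' s.
- move=> x; apply: (@continuous_comp _ _ _ (psi : realmod B -> realmod C)
    (phi : realmod C -> realmod D)); [exact: c'|exact: c].
Qed.

Lemma torus_relations_gauge t :
  torus_relations Theta (fun j => expi (t 0 j) *: nct_gen A j).
Proof.
have [un re] := nct_rel A; split=> [j|j k].
  rewrite starZ expi_conj -!scalerAl -!scalerAr !scalerA.
  by rewrite [_ (t 0 j) * _]mulrC expiNl !scale1r; exact: un.
rewrite -!scalerAl -!scalerAr re !scalerA; congr (_ *: _).
by rewrite mulrC mulrA [RHS]mulrAC.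
Qed.

Lemma gauge_subproof t : exists phi : A -> A,
  is_starhom phi /\ forall j, phi (nct_gen A j) = expi (t 0 j) *: nct_gen A j.
Proof.
by have [phi [phiP _]] := nct_universal A (torus_relations_gauge t); exists phi.
Qed.

(* the action on A of the point (e^(2 pi i t_j))_j of the n-torus *)
Definition gauge t : A -> A := sval (cid (gauge_subproof t)).

Lemma gauge_starhom t : is_starhom (gauge t).
Proof. by rewrite /gauge; case: cid => phi []. Qed.

Lemma gauge_gen t j : gauge t (nct_gen A j) = expi (t 0 j) *: nct_gen A j.
Proof. by rewrite /gauge; case: cid => phi []. Qed.

Lemma gauge_unique t (phi : A -> A) : is_starhom phi ->
  (forall j, phi (nct_gen A j) = expi (t 0 j) *: nct_gen A j) -> phi = gauge t.
Proof.
move=> h hg; have [psi [_ U]] := nct_universal A (torus_relations_gauge t).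
rewrite -(U phi)//; apply: U; split; [exact: gauge_starhom|exact: gauge_gen].
Qed.

Lemma gaugeD s t a : gauge (s + t) a = gauge s (gauge t a).
Proof.
rewrite -[RHS]/((gauge s \o gauge t) a); congr (_ a); apply/esym/gauge_unique.
  by apply: starhom_comp; exact: gauge_starhom.
move=> j /=; rewrite gauge_gen.
rewrite (starhomZ (gauge_starhom s)).
by rewrite gauge_gen scalerA mxE expiD mulrC.
Qed.

Lemma gauge0 a : gauge 0 a = a.
Proof.
suff -> : gauge 0 = id by [].
apply/esym/gauge_unique; first exact: starhom_id.
by move=> j; rewrite mxE expi0 scale1r.
Qed.

End Gauge.

Section SmoothVectors.
Variables (R : realType) (n : nat) (Theta : 'M[R]_n) (A : nctorus Theta).
Implicit Types (t : 'rV[R]_n) (a b : A).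

Definition orbit a : 'rV[R]_n -> realmod A := fun t => gauge t a.

Definition smooth_vector a : Prop := Cinfty (orbit a).

Definition smooth_pred : {pred A} := fun a => `[< smooth_vector a >].

Lemma smooth_predP a : reflect (smooth_vector a) (a \in smooth_pred).
Proof. exact: asboolP. Qed.

Lemma smooth_subalg_closed : subalg_closed smooth_pred.
Proof.
split=> [|c a b /smooth_predP sa /smooth_predP sb|
    a b /smooth_predP sa /smooth_predP sb]; apply/smooth_predP => k.
- rewrite (_ : orbit 1 = fun=> 1); first exact: Ck_cst.
  by apply/funext => t; exact: starhom1 (gauge_starhom A t).
- rewrite (_ : orbit _ = (fun t => c *: (orbit a t : A) : realmod A) \+ orbit b).
    by apply: Ck_add => //; exact: Ck_scale.
  by apply/funext => t; exact: starhom_linear (gauge_starhom A t) _ _ _.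
- rewrite (_ : orbit _ = fun t => (orbit a t : A) * (orbit b t : A) : realmod A).
    exact: Ck_mul.
  by apply/funext => t; exact: starhomM (gauge_starhom A t) _ _.
Qed.

Lemma smooth_star a : a \in smooth_pred -> star a \in smooth_pred.
Proof.
move=> /smooth_predP sa; apply/smooth_predP => k.
rewrite (_ : orbit _ = fun t => star (orbit a t : A) : realmod A).
  exact: Ck_star.
by apply/funext => t; exact: starhom_star (gauge_starhom A t) _.
Qed.

(* [pderiv j (u_k)] is 2 i pi u_k if j = k, and 0 otherwise *)
Definition pderiv (j : 'I_n) a : A := 'D_(delta_mx 0 j) (orbit a) 0.

Lemma derive_orbit j a t : smooth_vector a ->
  'D_(delta_mx 0 j) (orbit a) t = gauge t (pderiv j a).
Proof.
move=> sa; have [_ /(_ j)[da _]] := sa 1%N.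
have := derivable_quot (da 0) => d0.
have G := gauge_starhom A t.
pose q (h : R) : realmod A :=
  gauge t (h^-1 *: (orbit a (h *: delta_mx 0 j + 0) - orbit a 0)).
have qd : q @ 0^' --> (gauge t (pderiv j a) : realmod A).
  have cG : {for (pderiv j a : realmod A),
    continuous (gauge t : realmod A -> realmod A)} by exact: starhom_continuous.
  exact: (continuous_cvg _ cG d0).
apply: (proj2 (is_deriveP _ qd)) => h; rewrite /q.
rewrite [LHS](starhomZ G) (starhomB G); congr (_ *: (_ - _)).
  by rewrite addr0 /orbit [_ + t]addrC gaugeD.
by rewrite /orbit gauge0.
Qed.

Lemma smooth_pderiv j a : a \in smooth_pred -> pderiv j a \in smooth_pred.
Proof.
move=> /smooth_predP sa; apply/smooth_predP => k.
have [_ /(_ j)[_]] := sa k.+1; congr Ck.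
by apply/funext => t; exact: derive_orbit.
Qed.

(* A_Theta^infty *)
Record smooth_alg := SmoothAlg {
  smooth_val : A ;
  smooth_valP : smooth_val \in smooth_pred }.

HB.instance Definition _ := [isSub for smooth_val].
HB.instance Definition _ := [Choice of smooth_alg by <:].
HB.instance Definition _ := GRing.SubChoice_isSubAlgebra.Build R[i] A smooth_pred
  smooth_alg (GRing.subalg_closed_semi smooth_subalg_closed).

Implicit Types x y : smooth_alg.

Definition sstar x : smooth_alg := SmoothAlg (smooth_star (smooth_valP x)).

Fact sstarK : involutive sstar.
Proof. by move=> x; apply: val_inj; exact: starK. Qed.
Fact sstarD : {morph sstar : x y / x + y}.
Proof. by move=> x y; apply: val_inj; exact: starD. Qed.
Fact sstarZ (c : R[i]) x : sstar (c *: x) = c^*%C *: sstar x.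
Proof. by apply: val_inj; exact: starZ. Qed.
Fact sstarM x y : sstar (x * y) = sstar y * sstar x.
Proof. by apply: val_inj; exact: starM. Qed.

HB.instance Definition _ := Algebra_isStar.Build R smooth_alg
  sstarK sstarD sstarZ sstarM.

Definition partial (j : 'I_n) x : smooth_alg :=
  SmoothAlg (smooth_pderiv j (smooth_valP x)).

End SmoothVectors.

Section StarDerivations.
Variables (R : realType) (n : nat) (Theta : 'M[R]_n) (A : nctorus Theta).

Record starder := StarDer {
  starder_fun :> smooth_alg A -> smooth_alg A ;
  starder_linear : linear starder_fun ;
  starderM : forall a b,
    starder_fun (a * b) = starder_fun a * b + a * starder_fun b ;
  starder_star : {morph starder_fun : a / star a} }.

Implicit Types (X Y Z : starder).

Lemma starderP X Y : (forall a, X a = Y a) -> X = Y.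
Proof.
case: X Y => [f lf mf sf] [g lg mg sg] /= /funext fg; subst g.
by congr StarDer; exact: Prop_irrelevance.
Qed.

HB.instance Definition _ := gen_eqMixin starder.
HB.instance Definition _ := gen_choiceMixin starder.

Program Definition starder_add X Y : starder :=
  @StarDer (fun a => X a + Y a) _ _ _.
Next Obligation.
by move=> X Y c a b /=; rewrite !starder_linear scalerDr addrACA.
Qed.
Next Obligation.
by move=> X Y a b /=; rewrite !starderM mulrDl mulrDr addrACA.
Qed.
Next Obligation. by move=> X Y a /=; rewrite !starder_star starD. Qed.

Program Definition starder_zero : starder := @StarDer (fun=> 0) _ _ _.
Next Obligation. by move=> c a b; rewrite scaler0 addr0. Qed.
Next Obligation. by move=> a b; rewrite mul0r mulr0 addr0. Qed.
Next Obligation. by move=> a; rewrite star0. Qed.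

Program Definition starder_opp X : starder := @StarDer (fun a => - X a) _ _ _.
Next Obligation.
by move=> X c a b /=; rewrite starder_linear opprD scalerN.
Qed.
Next Obligation.
by move=> X a b /=; rewrite starderM opprD mulNr mulrN.
Qed.
Next Obligation. by move=> X a /=; rewrite starder_star starN. Qed.

Program Definition starder_scale (r : R) X : starder :=
  @StarDer (fun a => r%:C *: X a) _ _ _.
Next Obligation.
by move=> r X c a b /=; rewrite starder_linear scalerDr !scalerA mulrC.
Qed.
Next Obligation.
by move=> r X a b /=; rewrite starderM scalerDr scalerAl scalerAr.
Qed.
Next Obligation.
by move=> r X a /=; rewrite starder_star starZ conjc_real.
Qed.

Fact starder_addA : associative starder_add.
Proof. by move=> X Y Z; apply: starderP => a /=; rewrite addrA. Qed.
Fact starder_addC : commutative starder_add.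
Proof. by move=> X Y; apply: starderP => a /=; rewrite addrC. Qed.
Fact starder_add0 : left_id starder_zero starder_add.
Proof. by move=> X; apply: starderP => a /=; rewrite add0r. Qed.
Fact starder_addN : left_inverse starder_zero starder_opp starder_add.
Proof. by move=> X; apply: starderP => a /=; rewrite addNr. Qed.

HB.instance Definition _ := GRing.isZmodule.Build starder
  starder_addA starder_addC starder_add0 starder_addN.

Fact starder_scaleA r s X :
  starder_scale r (starder_scale s X) = starder_scale (r * s) X.
Proof. by apply: starderP => a /=; rewrite scalerA rmorphM. Qed.
Fact starder_scale1 : left_id 1 starder_scale.
Proof. by move=> X; apply: starderP => a /=; rewrite scale1r. Qed.
Fact starder_scaleDr : right_distributive starder_scale +%R.
Proof. by move=> r X Y; apply: starderP => a /=; rewrite scalerDr. Qed.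
Fact starder_scaleDl X : {morph starder_scale^~ X : r s / r + s}.
Proof.
by move=> r s; apply: starderP => a /=; rewrite rmorphD scalerDl.
Qed.

HB.instance Definition _ := GRing.Zmodule_isLmodule.Build R starder
  starder_scaleA starder_scale1 starder_scaleDr starder_scaleDl.

Let smoothP (a : smooth_alg A) : smooth_vector (val a).
Proof. by case: a => a /= /smooth_predP. Qed.

Fact partial_linear j : linear (@partial _ _ _ A j).
Proof.
move=> c a b; apply: val_inj => /=; rewrite /pderiv.
set f := orbit _.
have -> : f = (fun t => c *: (orbit (val a) t : A) : realmod A) \+ orbit (val b).
  by apply/funext => t; exact: starhom_linear (gauge_starhom A t) _ _ _.
have [_ /(_ j)[da _]] := smoothP a 1%N.
have [_ /(_ j)[db _]] := smoothP b 1%N.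
have [dca Dca] := derive_cscale c (da 0).
by rewrite deriveD// Dca.
Qed.

Fact partialM j (a b : smooth_alg A) :
  partial j (a * b) = partial j a * b + a * partial j b.
Proof.
apply: val_inj => /=; rewrite /pderiv.
set f := orbit _.
have -> : f =
    fun t => (orbit (val a) t : A) * (orbit (val b) t : A) : realmod A.
  by apply/funext => t; exact: starhomM (gauge_starhom A t) _ _.
have [_ /(_ j)[da _]] := smoothP a 1%N.
have [_ /(_ j)[db _]] := smoothP b 1%N.
by rewrite (derive_cmul (da 0) (db 0)).2 /orbit !gauge0.
Qed.

Fact partial_star j : {morph @partial _ _ _ A j : a / star a}.
Proof.
move=> a; apply: val_inj => /=; rewrite /pderiv.
set f := orbit _.
have -> : f = fun t => star (orbit (val a) t : A) : realmod A.
  by apply/funext => t; exact: starhom_star (gauge_starhom A t) _.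
have [_ /(_ j)[da _]] := smoothP a 1%N.
by rewrite (derive_star (da 0)).2.
Qed.

Definition pd (j : 'I_n) : starder :=
  StarDer (partial_linear j) (partialM j) (@partial_star j).

Definition is_inner X := exists a, forall b, X b = a * b - b * a.

End StarDerivations.

Definition simple_cstar (R : realType) (A : cstarAlgType R) : Prop :=
  forall I : set (realmod A), closed I -> I 0 ->
    (forall a b : A, I a -> I b -> I (a + b)) ->
    (forall a b : A, I b -> I (a * b) /\ I (b * a)) ->
    I = [set 0] \/ I = setT.

(* Generic transcendence of Theta, in the form in which it is used: A_Theta is
   simple and every *-derivation is a real combination of the partial
   derivatives plus an inner *-derivation. *)
Definition generic_nctorus (R : realType) n (Theta : 'M[R]_n)
    (A : nctorus Theta) : Prop :=
  simple_cstar A /\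
  forall X : starder A, exists (c : 'I_n -> R) (Z : starder A),
    is_inner Z /\ X = \sum_j c j *: pd A j + Z.

(* [trace_ge0], [trace1] and [trace_le]: a state is a positive linear functional
   of norm one *)
Record invariant_trace (R : realType) n (Theta : 'M[R]_n) (A : nctorus Theta) :=
  InvariantTrace {
    trace_fun :> A -> R[i] ;
    trace_linear : forall c a b, trace_fun (c *: a + b) = c * trace_fun a + trace_fun b ;
    trace_ge0 : forall a, 0 <= trace_fun (star a * a) ;
    trace1 : trace_fun 1 = 1 ;
    trace_le : forall a, normc (trace_fun a) <= cnorm a ;
    traceC : forall a b, trace_fun (a * b) = trace_fun (b * a) ;
    trace_gauge : forall t a, trace_fun (gauge t a) = trace_fun a }.

Section InnerLie.
Variables (R : realType) (n : nat) (Theta : 'M[R]_n) (A : nctorus Theta).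
Variable tau : invariant_trace A.

Definition gLie_pred : {pred realmod (smooth_alg A)} :=
  fun a => (star (a : smooth_alg A) == - (a : smooth_alg A)) &&
           (tau (val (a : smooth_alg A)) == 0).

Record gLie := GLie {
  gLie_val : realmod (smooth_alg A) ;
  gLie_valP : gLie_val \in gLie_pred }.

HB.instance Definition _ := [isSub for gLie_val].
HB.instance Definition _ := [Choice of gLie by <:].

Fact gLie_submod_closed : submod_closed gLie_pred.
Proof.
have t0 : tau 0 = 0.
  by have := trace_linear tau (-1) 0 0; rewrite scaler0 addr0 mulN1r addNr.
split; first by apply/andP; split; rewrite ?star0 ?oppr0//; apply/eqP.
move=> r a b /andP[/eqP sa /eqP ta] /andP[/eqP sb /eqP tb]; apply/andP; split.
  apply/eqP; rewrite starD [r *: a]/(r%:C *: (a : smooth_alg A)).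
  by rewrite starZ conjc_real sa sb opprD scalerN.
by rewrite -[val _]/(r%:C *: val (a : smooth_alg A) + val (b : smooth_alg A))
  trace_linear ta tb mulr0 addr0.
Qed.

HB.instance Definition _ := GRing.SubChoice_isSubLmodule.Build R
  (realmod (smooth_alg A)) gLie_pred gLie
  (GRing.submod_closed_semi gLie_submod_closed).

Definition ad_fun (a : gLie) (b : smooth_alg A) : smooth_alg A :=
  (val a : smooth_alg A) * b - b * (val a : smooth_alg A).

Fact ad_linear a : linear (ad_fun a).
Proof.
move=> c x y; rewrite /ad_fun mulrDr mulrDl -scalerAl -scalerAr.
by rewrite opprD addrACA -scalerBr.
Qed.

Fact adM a x y : ad_fun a (x * y) = ad_fun a x * y + x * ad_fun a y.
Proof. by rewrite /ad_fun mulrBl mulrBr !mulrA addrA subrK. Qed.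

Fact ad_star a : {morph ad_fun a : x / star x}.
Proof.
move=> x; rewrite /ad_fun starB !starM.
have /andP[/eqP -> _] := gLie_valP a.
by rewrite mulrN mulNr opprK addrC.
Qed.

Definition ad (a : gLie) : starder A :=
  StarDer (ad_linear a) (adM a) (@ad_star a).

End InnerLie.

Definition mxstar (R : realType) (B : starAlgType R) m n (M : 'M[B]_(m, n)) :
  'M[B]_(n, m) := (map_mx star M)^T.

(* self-adjoint with spectrum in the nonnegative reals *)
Definition mxpositive (R : realType) (B : starAlgType R) n (M : 'M[B]_n) : Prop :=
  mxstar M = M /\
  forall c : R[i],
    ~ (exists N, (M - c%:A%:M) *m N = 1%:M /\ N *m (M - c%:A%:M) = 1%:M) ->
    0 <= c.

Record metric (R : realType) n (Theta : 'M[R]_n) (A : nctorus Theta) := Metric {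
  metric_mx :> 'M[smooth_alg A]_n ;
  metric_inv : 'M[smooth_alg A]_n ;
  metric_sa : forall j k, star (metric_mx j k) = metric_mx j k ;
  metric_pos : mxpositive (map_mx val metric_mx : 'M[A]_n) ;
  metric_mulV : metric_mx *m metric_inv = 1%:M ;
  metric_mulVr : metric_inv *m metric_mx = 1%:M }.

Section SkewKernel.
Variables (R : realType) (n : nat) (Theta : 'M[R]_n) (A : nctorus Theta).
Variable gamma : metric A.

Definition skewker_pred : {pred 'M[smooth_alg A]_n} :=
  fun nu => mxstar nu + metric_inv gamma *m nu *m gamma == 0.

Record skewker := SkewKer {
  skewker_val : 'M[smooth_alg A]_n ;
  skewker_valP : skewker_val \in skewker_pred }.

HB.instance Definition _ := [isSub for skewker_val].
HB.instance Definition _ := [Choice of skewker by <:].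

Fact skewker_zmod_closed : zmod_closed skewker_pred.
Proof.
split=> [|nu mu /eqP nu0 /eqP mu0]; apply/eqP.
  by rewrite mulmx0 mul0mx addr0; apply/matrixP => i j; rewrite !mxE star0.
have -> : mxstar (nu - mu) = mxstar nu - mxstar mu.
  by apply/matrixP => i j; rewrite !mxE starB.
by rewrite mulmxBr mulmxBl addrACA -opprD nu0 mu0 subr0.
Qed.

HB.instance Definition _ := GRing.SubChoice_isSubZmodule.Build
  'M[smooth_alg A]_n skewker_pred skewker skewker_zmod_closed.

Definition mxrscale m p (r : R) (M : 'M[smooth_alg A]_(m, p)) :=
  map_mx (fun a => r%:C *: a) M.

Fact skewker_scale_subproof (r : R) (nu : skewker) :
  mxrscale r (val nu) \in skewker_pred.
Proof.
have /eqP nu0 := skewker_valP nu; apply/eqP.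
have -> : mxstar (mxrscale r (val nu)) = mxrscale r (mxstar (val nu)).
  by apply/matrixP => i j; rewrite !mxE starZ conjc_real.
have -> : metric_inv gamma *m mxrscale r (val nu) *m gamma =
    mxrscale r (metric_inv gamma *m val nu *m gamma).
  apply/matrixP => i j; rewrite !mxE scaler_sumr; apply: eq_bigr => k _.
  rewrite !mxE scalerAl scaler_sumr; congr (_ * _); apply: eq_bigr => l _.
  by rewrite !mxE scalerAr.
rewrite -[LHS]/(_ + _) -[RHS](_ : mxrscale r 0 = 0); last first.
  by apply/matrixP => i j; rewrite !mxE scaler0.
by rewrite -nu0; apply/matrixP => i j; rewrite !mxE scalerDr.
Qed.

Definition skewker_scale r nu := SkewKer (skewker_scale_subproof r nu).

Fact skewker_scaleA r s nu :
  skewker_scale r (skewker_scale s nu) = skewker_scale (r * s) nu.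
Proof.
by apply: val_inj; apply/matrixP => i j; rewrite !mxE scalerA rmorphM.
Qed.
Fact skewker_scale1 : left_id 1 skewker_scale.
Proof.
by move=> nu; apply: val_inj; apply/matrixP => i j; rewrite !mxE scale1r.
Qed.
Fact skewker_scaleDr : right_distributive skewker_scale +%R.
Proof.
by move=> r nu mu; apply: val_inj; apply/matrixP => i j; rewrite !mxE scalerDr.
Qed.
Fact skewker_scaleDl nu : {morph skewker_scale^~ nu : r s / r + s}.
Proof.
move=> r s; apply: val_inj; apply/matrixP => i j.
by rewrite !mxE rmorphD scalerDl.
Qed.

HB.instance Definition _ := GRing.Zmodule_isLmodule.Build R skewker
  skewker_scaleA skewker_scale1 skewker_scaleDr skewker_scaleDl.

End SkewKernel.

Section Connections.
Variables (R : realType) (n : nat) (Theta : 'M[R]_n) (A : nctorus Theta).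

(* the free left module chi_Theta; its basis is delta_mx 0 j *)
Definition chi := 'rV[smooth_alg A]_n.

Definition chi_basis (j : 'I_n) : chi := delta_mx 0 j.

Definition inner (gamma : metric A) (Y Z : chi) : smooth_alg A :=
  \sum_j \sum_k Y 0 j * gamma j k * star (Z 0 k).

Implicit Types (nabla : starder A -> chi -> chi) (gamma : metric A).

Record is_connection nabla : Prop := {
  connection_linearl : forall (r : R) X X' Y,
    nabla (r *: X + X') Y = mxrscale r (nabla X Y) + nabla X' Y ;
  connection_linearr : forall (r : R) X Y Y',
    nabla X (mxrscale r Y + Y') = mxrscale r (nabla X Y) + nabla X Y' ;
  connection_leibniz : forall X (a : smooth_alg A) Y,
    nabla X (a *: Y) = X a *: Y + a *: nabla X Y }.

Definition metric_compatible gamma nabla : Prop := forall (X : starder A) Y Z,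
  X (inner gamma Y Z) =
    inner gamma (nabla X Y) Z + inner gamma Y (nabla X Z).

Definition torsion_free nabla : Prop := forall j k,
  nabla (pd A j) (chi_basis k) = nabla (pd A k) (chi_basis j).

Definition real_connection gamma nabla : Prop := forall j k l,
  star (inner gamma (nabla (pd A j) (chi_basis k)) (chi_basis l)) =
    inner gamma (nabla (pd A j) (chi_basis k)) (chi_basis l).

Record is_levi_civita (tau : invariant_trace A) gamma nabla : Prop := {
  levi_civita_connection : is_connection nabla ;
  levi_civita_compatible : metric_compatible gamma nabla ;
  levi_civita_torsion_free : torsion_free nabla ;
  levi_civita_real : real_connection gamma nabla ;
  levi_civita_ad : forall (a : gLie tau) Y,
    nabla (ad a) Y = (val a : smooth_alg A) *: Y }.

(* [nabla'] is the connection [nabla + mu]; a matrix acts on row vectors by right multiplication *)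
Record is_translate (tau : invariant_trace A) gamma nabla
    (mu : {linear gLie tau -> skewker gamma}) nabla' : Prop := {
  translate_connection : is_connection nabla' ;
  translate_pd : forall (c : 'I_n -> R) Y,
    nabla' (\sum_j c j *: pd A j) Y = nabla (\sum_j c j *: pd A j) Y ;
  translate_ad : forall (a : gLie tau) Y,
    nabla' (ad a) Y = nabla (ad a) Y + Y *m val (mu a) }.

End Connections.

(* Main.v *)
(* Two connections differ, in each direction [X], by right multiplication by a
   matrix which depends linearly on [X], and compatibility with the metric puts
   this matrix in ker(star + Ad_gamma^-1).  In the directions of the partial
   derivatives the Koszul argument forces it to vanish: the coefficients
   <d_k M_j, d_l> are self-adjoint, hence skew in (k, l), and they are symmetric
   in (j, k).  So only the inner directions are free, and there every linear mu
   is allowed, because the span of the partial derivatives and the inner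
   derivations are in direct sum.  For the nontriviality, i gamma^-1 lies in the
   kernel, and a |-> Re tau(a0^* a) is a nonzero functional on the Lie algebra
   for a0 = u_k - u_k^*. *)
Require Import Defs.
From HB Require Import structures.
From mathcomp Require Import all_boot all_order all_algebra complex.
From mathcomp Require Import boolp classical_sets functions reals topology.
From mathcomp Require Import normedtype derive realfun trigo.
From mathcomp Require Import ring lra.

Set Implicit Arguments.
Unset Strict Implicit.
Unset Printing Implicit Defensive.

Import Order.TTheory GRing.Theory Num.Theory numFieldNormedType.Exports.

Local Open Scope classical_set_scope.
Local Open Scope ring_scope.
Local Open Scope complex_scope.

(** * Smoothness of the generators under the gauge action *)

Section GeneratorsSmooth.
Variables (R : realType) (n : nat) (A : cstarAlgType R).
Implicit Types (t : 'rV[R]_n) (a b : realmod A).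

(** A family closed under partial derivatives up to real factors. Since e^(2 pi i s) u = cos(2 pi s)
    u + sin(2 pi s) (i u), it contains the orbits of the generators. *)
Definition trig_curve (k : 'I_n) a b t : realmod A :=
  cos (2 * pi * t 0 k) *: a + sin (2 * pi * t 0 k) *: b.

Lemma quot_is_derive1 (F : R -> R) (d : R) : is_derive (0 : R) 1 F d ->
  (fun h : R => h^-1 *: (F h - F 0)) @ 0^' --> d.
Proof.
move=> [dF <-]; apply: cvg_trans dF; apply: near_eq_cvg.
by near=> h; rewrite /= addr0 [_ *: 1]mulr1.
Unshelve. all: by end_near. Qed.

Lemma derive_trig_curve k j a b t :
  derivable (trig_curve k a b) t (delta_mx 0 j) /\
  'D_(delta_mx 0 j) (trig_curve k a b) t =
    (2 * pi * (j == k)%:R) *: trig_curve k b (- a) t.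
Proof.
pose e : R := 2 * pi * (j == k)%:R; pose s : R := 2 * pi * t 0 k.
have coord h : 2 * pi * (h *: delta_mx 0 j + t) 0 k = e * h + s :> R.
  by rewrite !mxE eqxx /= [k == j]eq_sym mulrDr mulrCA [e * h]mulrC.
have lin : is_derive (0 : R) 1 (fun h => e * h + s) e.
  have := is_deriveD (is_deriveZ e (is_derive_id (0 : R) 1))
    (is_derive_cst s (0 : R) 1).
  by rewrite addr0 [_ *: 1]mulr1.
have dcos : is_derive (0 : R) 1 (fun h => cos (e * h + s)) (- sin s * e).
  have := @is_derive1_comp _ cos (fun h => e * h + s) 0 _ _ (is_derive_cos _) lin.
  by rewrite mulr0 add0r.
have dsin : is_derive (0 : R) 1 (fun h => sin (e * h + s)) (cos s * e).
  have := @is_derive1_comp _ sin (fun h => e * h + s) 0 _ _ (is_derive_sin _) lin.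
  by rewrite mulr0 add0r.
(* The difference quotient splits into two real quotients times the fixed vectors [a] and [b], which
   reduces the limit to one-variable calculus. *)
have dq : (fun h : R => (h^-1 *: (cos (e * h + s) - cos (e * 0 + s))) *: a +
    (h^-1 *: (sin (e * h + s) - sin (e * 0 + s))) *: b) @ 0^' -->
    (- sin s * e) *: a + (cos s * e) *: b.
  by apply: cvgD; apply: cvgZr_tmp; exact: quot_is_derive1.
have -> : (2 * pi * (j == k)%:R) *: trig_curve k b (- a) t =
    (- sin s * e) *: a + (cos s * e) *: b.
  rewrite /trig_curve -/s -/e scalerDr !scalerA scalerN addrC mulrC -scaleNr.
  by rewrite mulNr [e * cos _]mulrC.
apply: (is_deriveP _ dq) => h /=.
rewrite /trig_curve !coord -/s mulr0 add0r -!scalerA -scalerDr !scalerBl.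
by rewrite opprD addrACA.
Qed.

(** A derivative is a multiple of the curve with coefficients [b] and [- a], so the induction on [m]
    keeps both coefficients general. *)
Lemma Ck_trig_curve m k a b : Ck m (trig_curve k a b).
Proof.
have cont a' b' : continuous (trig_curve k a' b').
  move=> t; have c : (fun t : 'rV[R]_n => 2 * pi * t 0 k) @ t --> 2 * pi * t 0 k.
    exact: (cvgMl_tmp (F := nbhs t) (@coord_continuous R 1 n 0 k t)).
  have cc : (fun u : 'rV[R]_n => cos (2 * pi * u 0 k)) @ t --> cos (2 * pi * t 0 k).
    exact: (continuous_cvg (F := nbhs t) _ (@continuous_cos R _) c).
  have cs : (fun u : 'rV[R]_n => sin (2 * pi * u 0 k)) @ t --> sin (2 * pi * t 0 k).
    exact: (continuous_cvg (F := nbhs t) _ (@continuous_sin R _) c).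
  exact: (cvgD (F := nbhs t) (cvgZr_tmp (F := nbhs t) cc) (cvgZr_tmp (F := nbhs t) cs)).
elim: m a b => [|m IH] a b; split => // j.
split=> [t|]; first by case: (derive_trig_curve k j a b t).
rewrite (_ : 'D__ _ = fun t => (2 * pi * (j == k)%:R)%:C *:
  (trig_curve k b (- a) t : A) : realmod A); first exact/Ck_scale/IH.
by apply/funext => t; case: (derive_trig_curve k j a b t).
Qed.

End GeneratorsSmooth.

Section Generators.
Variables (R : realType) (n : nat) (Theta : 'M[R]_n) (A : nctorus Theta).

Lemma orbit_gen (k : 'I_n) :
  Defs.orbit (nct_gen A k) = trig_curve k (nct_gen A k) ('i *: nct_gen A k).
Proof.
apply/funext => t; rewrite /Defs.orbit gauge_gen.
have -> : expi (t 0 k) =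
    (cos (2 * pi * t 0 k))%:C + (sin (2 * pi * t 0 k))%:C * 'i.
  by apply/eqP; rewrite eq_complex /= !(mul0r, mulr0, mulr1, subr0, addr0, add0r) !eqxx.
by rewrite scalerDl -scalerA.
Qed.

Lemma smooth_gen (k : 'I_n) : nct_gen A k \in smooth_pred (A := A).
Proof. by apply/smooth_predP => m; rewrite orbit_gen; exact: Ck_trig_curve. Qed.

Definition sgen (k : 'I_n) : smooth_alg A := SmoothAlg (smooth_gen k).

Lemma partial_sgen j k :
  partial j (sgen k) = (2 * pi * (j == k)%:R)%:C *: ('i *: sgen k).
Proof.
apply: val_inj; rewrite /= /pderiv orbit_gen (derive_trig_curve _ _ _ _ _).2.
by rewrite /trig_curve mxE mulr0 cos0 sin0 scale1r scale0r addr0.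
Qed.

Lemma sgen_starK k : sgen k * star (sgen k) = 1.
Proof. by apply: val_inj; exact: ((nct_rel A).1 k).2. Qed.

End Generators.

(** * Adjoints and real multiples of matrices *)

Section MatrixStar.
Variables (R : realType) (B : starAlgType R).

Lemma star_sum I (r : seq I) (P : pred I) (F : I -> B) :
  star (\sum_(i <- r | P i) F i) = \sum_(i <- r | P i) star (F i).
Proof. exact: (big_morph _ (@starD R B) (star0 B)). Qed.

Lemma mxstarK m n : cancel (@mxstar R B m n) (@mxstar R B n m).
Proof. by move=> M; apply/matrixP => i j; rewrite !mxE starK. Qed.

Lemma mxstarD m n (M N : 'M[B]_(m, n)) : mxstar (M + N) = mxstar M + mxstar N.
Proof. by apply/matrixP => i j; rewrite !mxE starD. Qed.

Lemma mxstarM m n p (M : 'M[B]_(m, n)) (N : 'M[B]_(n, p)) :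
  mxstar (M *m N) = mxstar N *m mxstar M.
Proof.
apply/matrixP => i j; rewrite !mxE star_sum; apply: eq_bigr => k _.
by rewrite !mxE starM.
Qed.

Lemma mxstar1 n : mxstar (1%:M : 'M[B]_n) = 1%:M.
Proof.
apply/matrixP => i j; rewrite !mxE eq_sym.
by case: eqP; rewrite ?star1 ?star0.
Qed.

Lemma mxstarZ m n (c : R[i]) (M : 'M[B]_(m, n)) :
  mxstar (map_mx (fun a => c *: a) M) = map_mx (fun a => c^*%C *: a) (mxstar M).
Proof. by apply/matrixP => i j; rewrite !mxE starZ. Qed.

End MatrixStar.

Section RealScaling.
Variables (R : realType) (n : nat) (Theta : 'M[R]_n) (A : nctorus Theta).
Let S := smooth_alg A.

Lemma mxrscale_mulmx m p q (r : R) (M : 'M[S]_(m, p)) (N : 'M[S]_(p, q)) :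
  mxrscale r (M *m N) = mxrscale r M *m N.
Proof.
apply/matrixP => i j; rewrite !mxE scaler_sumr; apply: eq_bigr => k _.
by rewrite mxE scalerAl.
Qed.

Lemma mulmx_mxrscale m p q (r : R) (M : 'M[S]_(m, p)) (N : 'M[S]_(p, q)) :
  mxrscale r (M *m N) = M *m mxrscale r N.
Proof.
apply/matrixP => i j; rewrite !mxE scaler_sumr; apply: eq_bigr => k _.
by rewrite mxE scalerAr.
Qed.

Lemma mxrscaleD m p (r : R) (M N : 'M[S]_(m, p)) :
  mxrscale r (M + N) = mxrscale r M + mxrscale r N.
Proof. by apply/matrixP => i j; rewrite !mxE scalerDr. Qed.

Lemma mxrscale1 m p (M : 'M[S]_(m, p)) : mxrscale 1 M = M.
Proof. by apply/matrixP => i j; rewrite !mxE scale1r. Qed.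

Lemma mxrscale0 m p r : mxrscale r 0 = 0 :> 'M[S]_(m, p).
Proof. by apply/matrixP => i j; rewrite !mxE scaler0. Qed.

Lemma starder_sumE (c : 'I_n -> R) (b : S) :
  (\sum_j c j *: pd A j) b = \sum_j (c j)%:C *: partial j b.
Proof. exact: (big_morph (fun X : starder A => X b)). Qed.

End RealScaling.

(** * The metric in matrix form, and the matrices that are skew for it *)

Section InnerProduct.
Variables (R : realType) (n : nat) (Theta : 'M[R]_n) (A : nctorus Theta).
Variable gamma : metric A.
Implicit Types (Y Z : chi A) (b : smooth_alg A).

(** Self-adjoint entries alone would only give the transpose of [gamma]. The identity comes from
    positivity, which is stated over [A], hence the passage through [val]. *)
Lemma mxstar_metric : mxstar (gamma : 'M_n) = gamma.
Proof.
apply/matrixP => i j; apply: val_inj.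
by have := congr1 (fun M : 'M_n => M i j) (metric_pos gamma).1; rewrite !mxE.
Qed.

Lemma mxstar_metric_inv : mxstar (metric_inv gamma) = metric_inv gamma.
Proof.
rewrite -[LHS]mulmx1 -(metric_mulV gamma) mulmxA -mxstar_metric -mxstarM.
by rewrite metric_mulV mxstar1 mul1mx.
Qed.

Lemma innerE Y Z : inner gamma Y Z = (Y *m gamma *m mxstar Z) 0 0.
Proof.
rewrite /inner exchange_big mxE; apply: eq_bigr => k _.
by rewrite !mxE mulr_suml.
Qed.

Lemma innerDl Y Y' Z : inner gamma (Y + Y') Z = inner gamma Y Z + inner gamma Y' Z.
Proof. by rewrite !innerE !mulmxDl mxE. Qed.

Lemma innerDr Y Z Z' : inner gamma Y (Z + Z') = inner gamma Y Z + inner gamma Y Z'.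
Proof. by rewrite !innerE mxstarD mulmxDr mxE. Qed.

Lemma innerBl Y Y' Z : inner gamma (Y - Y') Z = inner gamma Y Z - inner gamma Y' Z.
Proof. by rewrite !innerE !mulmxBl !mxE. Qed.

Lemma innerC Y Z : inner gamma Z Y = star (inner gamma Y Z).
Proof.
rewrite !innerE -[RHS]/((fun a => star a) _).
have -> (M : 'M_1) : star (M 0 0) = mxstar M 0 0 :> smooth_alg A by rewrite !mxE.
by rewrite !mxstarM mxstarK mxstar_metric mulmxA.
Qed.

Lemma mxstar_basis l : mxstar (chi_basis A l) = delta_mx l 0.
Proof.
apply/matrixP => i j; rewrite !mxE andbC.
by case: (_ && _); rewrite ?star1 ?star0.
Qed.

Lemma inner_basisr Y l : inner gamma Y (chi_basis A l) = (Y *m gamma) 0 l.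
Proof. by rewrite innerE mxstar_basis -colE mxE. Qed.

(** The pairings with the basis are the entries of [Y *m gamma], and [gamma] is invertible. *)
Lemma inner_nondegenerate Y : (forall l, inner gamma Y (chi_basis A l) = 0) -> Y = 0.
Proof.
move=> Y0; rewrite -[Y]mulmx1 -(metric_mulV gamma) mulmxA.
suff -> : Y *m gamma = 0 by rewrite mul0mx.
by apply/rowP => l; rewrite -inner_basisr Y0 mxE.
Qed.

(** Left multiplication by [gamma] clears the inverse from the kernel equation and is reversible. *)
Lemma skewkerP (nu : 'M_n) :
  nu \in skewker_pred gamma <-> nu *m gamma + gamma *m mxstar nu = 0.
Proof.
split=> [/eqP nu0|nu0].
  rewrite addrC -[nu *m _]mul1mx -(metric_mulV gamma) -[_ *m metric_inv _ *m _]mulmxA.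
  by rewrite -mulmxDr mulmxA nu0 mulmx0.
apply/eqP; rewrite -mulmxA addrC -[mxstar nu]mul1mx -(metric_mulVr gamma).
by rewrite -[_ *m gamma *m _]mulmxA -mulmxDr nu0 mulmx0.
Qed.

(** This is the form in which the kernel meets metric compatibility; testing on basis vectors
    recovers the matrix equation. *)
Lemma inner_skewker (nu : 'M_n) : nu \in skewker_pred gamma <->
  (forall Y Z, inner gamma (Y *m nu) Z + inner gamma Y (Z *m nu) = 0).
Proof.
split=> [/skewkerP nu0 Y Z|nu0].
  have addE (M N : 'M[smooth_alg A]_1) : M 0 0 + N 0 0 = (M + N) 0 0 by rewrite mxE.
  rewrite !innerE mxstarM addE.
  rewrite !mulmxA -mulmxDl -(mulmxA Y) -(mulmxA Y) -mulmxDr.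
  by rewrite nu0 mulmx0 mul0mx mxE.
apply/skewkerP/matrixP => j k; have := nu0 (chi_basis A j) (chi_basis A k).
rewrite !innerE mxstarM mxstar_basis -!rowE.
rewrite mulmxA -colE -colE -!row_mul !mxE.
by [].
Qed.

End InnerProduct.

Lemma eqN_eq0 (R : realType) (V : lmodType R[i]) (x : V) : x = - x -> x = 0.
Proof.
move=> xN; have : (2%:R : R[i]) *: x = 0 by rewrite scaler_nat mulr2n {2}xN subrr.
by move/eqP; rewrite scaler_eq0 pnatr_eq0 => /eqP.
Qed.

Lemma expi_half (R : realType) : expi (2^-1) = -1 :> R[i].
Proof.
rewrite /expi mulrAC divff ?mul1r ?cospi ?sinpi ?pnatr_eq0//.
by apply/eqP; rewrite eq_complex /= oppr0 !eqxx.
Qed.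

(** The core of the Koszul argument: alternating the two exchanges three times each returns to (j,
    k, l) with total sign (-1)^3, so each value is its own negative. *)
Lemma sym_skew_eq0 (I : Type) (R : realType) (V : lmodType R[i])
    (D : I -> I -> I -> V) :
  (forall j k l, D j k l = D k j l) -> (forall j k l, D j k l = - D j l k) ->
  forall j k l, D j k l = 0.
Proof.
move=> sym skew j k l; apply: eqN_eq0.
rewrite {1}(skew j k l) (sym j l k) (skew l j k) opprK.
by rewrite (sym l k j) (skew k l j) (sym k j l).
Qed.

(** * Hermitian symmetry of the trace and its values on generators *)

Section Trace.
Variables (R : realType) (n : nat) (Theta : 'M[R]_n) (A : nctorus Theta).
Variable tau : invariant_trace A.
Implicit Types (a b : A).

Lemma traceD a b : tau (a + b) = tau a + tau b.
Proof. by rewrite -[a]scale1r trace_linear mul1r scale1r. Qed.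

Lemma trace0 : tau 0 = 0.
Proof. by apply: (@addrI _ (tau 0)); rewrite -traceD !addr0. Qed.

Lemma traceZ (c : R[i]) a : tau (c *: a) = c * tau a.
Proof. by rewrite -[c *: a]addr0 trace_linear trace0 addr0. Qed.

Lemma traceN a : tau (- a) = - tau a.
Proof. by rewrite -scaleN1r traceZ mulN1r. Qed.

Lemma traceB a b : tau (a - b) = tau a - tau b.
Proof. by rewrite traceD traceN. Qed.

Lemma trace_star a : tau (star a) = (tau a)^*%C.
Proof.
have im0 (c : R[i]) : complex.Im (c * tau a + c^*%C * tau (star a)) = 0.
  have p := trace_ge0 tau (1 + c *: a).
  have q := trace_ge0 tau (c *: a).
  move: p; rewrite starD star1 mulrDl mulrDr mulrDr !mul1r mulr1 !traceD trace1.
  move: q; rewrite starZ [tau (c *: a)]traceZ [tau (c^*%C *: _)]traceZ.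
  rewrite !lecE !raddfD /= => /andP[/eqP q _] /andP[/eqP p _].
  by move: p; rewrite q; lra.
have := im0 1; have := im0 'i.
case: (tau a) (tau (star a)) => x y [x' y'] /=.
rewrite !(mul0r, mul1r, mulN1r, oppr0, mulNr) => p q.
by apply/eqP; rewrite eq_complex /=; apply/andP; split; apply/eqP; lra.
Qed.

Lemma trace_gen k : tau (nct_gen A k) = 0.
Proof.
(* A half turn sends u_k to - u_k, and the trace is invariant. *)
have := trace_gauge tau (const_mx 2^-1) (nct_gen A k).
rewrite gauge_gen mxE expi_half traceZ mulN1r => /esym.
exact: (@eqN_eq0 _ R[i]^o).
Qed.

Lemma trace_gen2 k : tau (nct_gen A k * nct_gen A k) = 0.
Proof.
(* A quarter turn sends u_k to i u_k, hence u_k^2 to - u_k^2. *)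
have := trace_gauge tau (const_mx 4^-1) (nct_gen A k * nct_gen A k).
rewrite (starhomM (gauge_starhom A _)) gauge_gen mxE -scalerAl -scalerAr scalerA.
rewrite -expiD (_ : 4^-1 + 4^-1 = 2^-1); last by field.
rewrite expi_half traceZ mulN1r => /esym.
exact: (@eqN_eq0 _ R[i]^o).
Qed.

End Trace.

(** * Inner *-derivations and their skew-adjoint, trace-zero generators *)

Section InnerDerivations.
Variables (R : realType) (n : nat) (Theta : 'M[R]_n) (A : nctorus Theta).
Variable tau : invariant_trace A.
Let S := smooth_alg A.

Lemma gLie_val_linear (r : R) (a b : gLie tau) :
  (val (r *: a + b) : S) = r%:C *: (val a : S) + (val b : S).
Proof. by []. Qed.

Lemma ad_linearP (r : R) (a b : gLie tau) : ad (r *: a + b) = r *: ad a + ad b.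
Proof.
apply: starderP => x; rewrite /= /ad_fun gLie_val_linear.
by rewrite mulrDl mulrDr opprD addrACA scalerBr scalerAl scalerAr.
Qed.

Lemma adB (a b : gLie tau) : ad (a - b) = ad a - ad b.
Proof. by rewrite addrC -scaleN1r ad_linearP scaleN1r addrC. Qed.

Lemma ad0 : ad (0 : gLie tau) = 0.
Proof. by rewrite -(subrr 0) adB subrr. Qed.

Lemma is_inner_ad (Z : starder A) : is_inner Z -> exists a : gLie tau, Z = ad a.
Proof.
move=> [a Za].
(* Centrality of a + a^* expresses that [Z] commutes with the star. *)
have comm_sum b : (a + star a) * b = b * (a + star a).
  have /eqP := starder_star Z (star b).
  rewrite starK !Za starB !starM !starK mulrDl mulrDr.
  rewrite subr_eq addrAC eq_sym subr_eq => /eqP <-.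
  by rewrite addrC.
pose h : S := 2^-1 *: (a - star a).
have star_h : star h = - h.
  rewrite /h starZ starB starK -scalerN opprB; congr (_ *: _).
  by rewrite fmorphV rmorph_nat.
have hE : h = a - 2^-1 *: (a + star a).
  rewrite /h !scalerBr !scalerDr opprD addrA; congr (_ - _).
  rewrite -[X in _ = X - _]scale1r -scalerBl; congr (_ *: _).
  by field.
clearbody h.
have tau_h : (tau (val h))^*%C = - tau (val h).
  by rewrite -trace_star -[star _]/(val (star h)) star_h traceN.
pose g : S := h - tau (val h) *: 1.
have gP : g \in gLie_pred tau.
  apply/andP; split; apply/eqP.
    by rewrite /g starB star_h starZ star1 tau_h scaleNr opprB opprK addrC.
  rewrite -[val _]/(val h - tau (val h) *: (1 : A)) traceB.
  by rewrite [tau (_ *: _)]traceZ trace1 mulr1 subrr.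
exists (GLie gP); apply: starderP => b; rewrite Za /= /ad_fun /= /g hE.
rewrite !mulrBl !mulrBr -!scalerAl -!scalerAr mul1r mulr1 comm_sum.
by rewrite opprB subrKA opprB subrKA.
Qed.

End InnerDerivations.

(** * The difference of two connections *)

Section Connections.
Variables (R : realType) (n : nat) (Theta : 'M[R]_n) (A : nctorus Theta).
Let S := smooth_alg A.

Lemma tensorial_mulmx (F : chi A -> chi A) :
  (forall Y Y', F (Y + Y') = F Y + F Y') ->
  (forall (a : S) Y, F (a *: Y) = a *: F Y) ->
  forall Y, F Y = Y *m \matrix_k F (chi_basis A k).
Proof.
move=> FD FZ Y; have F0 : F 0 = 0 by have := FZ 0 0; rewrite !scale0r.
rewrite {1}[Y]row_sum_delta (big_morph F FD F0) mulmx_sum_row.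
by apply: eq_bigr => k _; rewrite FZ rowK.
Qed.

Section ConnectionTheory.
Variable nabla : starder A -> chi A -> chi A.
Hypothesis conn : is_connection nabla.

Lemma connection_addl X X' Y : nabla (X + X') Y = nabla X Y + nabla X' Y.
Proof.
by have := connection_linearl conn 1 X X' Y; rewrite [1 *: X]scale1r mxrscale1.
Qed.

Lemma connection_addr X Y Y' : nabla X (Y + Y') = nabla X Y + nabla X Y'.
Proof. by have := connection_linearr conn 1 X Y Y'; rewrite !mxrscale1. Qed.

Lemma connection0l Y : nabla 0 Y = 0.
Proof. by apply: (@addrI _ (nabla 0 Y)); rewrite -connection_addl !addr0. Qed.

End ConnectionTheory.

Section ConnectionDifference.
Variables nabla nabla' : starder A -> chi A -> chi A.
Hypotheses (conn : is_connection nabla) (conn' : is_connection nabla').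

Definition connection_diff X : 'M[S]_n :=
  \matrix_k (nabla' X (chi_basis A k) - nabla X (chi_basis A k)).

(** The derivative terms of the two Leibniz rules cancel, so the difference is linear over the
    algebra and is given by its values on the basis. *)
Lemma connection_diffE X Y : nabla' X Y = nabla X Y + Y *m connection_diff X.
Proof.
apply/eqP; rewrite addrC -subr_eq; apply/eqP.
apply: (tensorial_mulmx (F := fun Y => nabla' X Y - nabla X Y)) => [Y1 Y2|a Y1].
  by rewrite (connection_addr conn) (connection_addr conn') opprD addrACA.
rewrite (connection_leibniz conn) (connection_leibniz conn').
by rewrite opprD addrACA subrr add0r -scalerBr.
Qed.

Lemma connection_diff_linear (r : R) X X' :
  connection_diff (r *: X + X') =
    mxrscale r (connection_diff X) + connection_diff X'.
Proof.
apply/matrixP => k l; rewrite !mxE (connection_linearl conn) (connection_linearl conn').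
by rewrite !mxE opprD addrACA -scalerBr.
Qed.

Lemma connection_diff_skewker (gamma : metric A) X :
  metric_compatible gamma nabla -> metric_compatible gamma nabla' ->
  connection_diff X \in skewker_pred gamma.
Proof.
move=> comp comp'; apply/inner_skewker => Y Z.
have := comp' X Y Z; rewrite comp !connection_diffE innerDl innerDr addrACA.
by rewrite -[LHS]addr0 => /addrI.
Qed.

Lemma connection_diff_pd (gamma : metric A) j :
  metric_compatible gamma nabla -> metric_compatible gamma nabla' ->
  torsion_free nabla -> torsion_free nabla' ->
  real_connection gamma nabla -> real_connection gamma nabla' ->
  connection_diff (pd A j) = 0.
Proof.
move=> comp comp' tf tf' re re'.
pose B := chi_basis A.
have BE i k : B k *m connection_diff (pd A i) =
    nabla' (pd A i) (B k) - nabla (pd A i) (B k).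
  by rewrite -rowE rowK.
pose D i k l := inner gamma (B k *m connection_diff (pd A i)) (B l).
have D0 i k l : D i k l = 0.
  move: i k l; apply: sym_skew_eq0 => i k l.
    by rewrite /D !BE tf tf'.
  (* For the skewness in the last two indices: the kernel equation moves the matrix to the other
     argument, exchanging the arguments costs a star, and reality of both connections removes it. *)
  apply/eqP; rewrite -addr_eq0.
  rewrite -[X in _ + X](_ : inner gamma (B k) (B l *m connection_diff (pd A i)) = _).
    have /inner_skewker H := connection_diff_skewker (pd A i) comp comp'.
    by rewrite /D H.
  by rewrite innerC /D BE innerBl starB re re'.
apply/row_matrixP => k; rewrite row0 rowE.
by apply: (@inner_nondegenerate _ _ _ _ gamma) => l; exact: D0.
Qed.

End ConnectionDifference.
End Connections.

(** * Splitting directions into partial and inner parts, and translates of the Levi-Civita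
    connection *)

Section Decomposition.
Variables (R : realType) (n : nat) (Theta : 'M[R]_n) (A : nctorus Theta).
Variables (tau : invariant_trace A) (gamma : metric A).
Variable nabla0 : starder A -> chi A -> chi A.
Hypothesis n_gt0 : (0 < n)%N.
Hypothesis A_generic : generic_nctorus A.
Hypothesis nabla0_LC : is_levi_civita tau gamma nabla0.
Let S := smooth_alg A.
Let conn0 := levi_civita_connection nabla0_LC.

(* [nabla0 (ad a)] is multiplication by [a], so [ad a] determines [a]. *)
Lemma ad_eq0 (a : gLie tau) : ad a = 0 -> a = 0.
Proof.
move=> a0; apply: val_inj.
have := levi_civita_ad nabla0_LC a (chi_basis A (Ordinal n_gt0)).
rewrite a0 (connection0l conn0) => /rowP/(_ (Ordinal n_gt0)).
by rewrite !mxE !eqxx mulr1.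
Qed.

(* Multiplying [D u_k = a u_k - u_k a] by [star u_k] on the right and applying
   the trace kills the right-hand side. *)
Lemma partials_not_inner (c : 'I_n -> R) (a : gLie tau) :
  \sum_j c j *: pd A j = ad a -> forall k, c k = 0.
Proof.
move=> ca k; have := congr1 (fun X : starder A => X (sgen A k)) ca.
rewrite starder_sumE (bigD1 k)//= big1 => [|j jk]; last first.
  by rewrite partial_sgen (negbTE jk) mulr0 scale0r scaler0.
rewrite addr0 partial_sgen eqxx mulr1 !scalerA.
set z := _ * 'i; pose u : S := sgen A k; pose b : S := val a => e.
have {}e : z *: u = b * u - u * b by exact: e.
have : z *: (1 : S) = b - u * b * star u.
  transitivity (z *: u * star u); first by rewrite -scalerAl sgen_starK.
  by rewrite e mulrBl -!mulrA sgen_starK mulr1.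
move/(congr1 (fun x : S => tau (val x))).
rewrite -[X in tau X = _]/(_ *: (1 : A)) traceZ trace1 mulr1.
rewrite -[X in _ = tau X]/(val b - nct_gen A k * val b * star (nct_gen A k)).
rewrite traceB traceC mulrA ((nct_rel A).1 k).1 mul1r subrr.
move=> /eqP; rewrite !mulf_eq0 -!(rmorph0 (real_complex R)) !(inj_eq (@complexI R)).
rewrite mulf_eq0 pnatr_eq0 (gt_eqF (pi_gt0 R)) !orbF /=.
rewrite eq_complex /= oner_eq0 andbF orbF.
by move/eqP.
Qed.

Lemma inner_part_exists (X : starder A) : exists (a : gLie tau),
  exists c : 'I_n -> R, X = \sum_j c j *: pd A j + ad a.
Proof.
have [_ /(_ X)[c [Z [/(is_inner_ad tau)[a ->] ->]]]] := A_generic.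
by exists a, c.
Qed.

(** The projection onto the Lie algebra along the span of the partial derivatives. It is picked by
    choice; uniqueness of the decomposition makes it linear. *)
Definition inner_part X : gLie tau := sval (cid (inner_part_exists X)).

Lemma inner_partP X : exists c : 'I_n -> R,
  X = \sum_j c j *: pd A j + ad (inner_part X).
Proof. exact: svalP (cid (inner_part_exists X)). Qed.

(** Subtracting two decompositions exhibits a combination of partial derivatives as inner; its
    coefficients vanish, and [ad] is injective. *)
Lemma inner_part_unique (c : 'I_n -> R) (a : gLie tau) :
  inner_part (\sum_j c j *: pd A j + ad a) = a.
Proof.
have [c' e] := inner_partP (\sum_j c j *: pd A j + ad a).
set b := inner_part _ in e *.
have cc' : \sum_j (c j - c' j) *: pd A j = ad (b - a).
  under eq_bigr do rewrite scalerBl.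
  rewrite sumrB adB; apply/eqP; rewrite subr_eq addrAC -subr_eq opprK; apply/eqP.
  by rewrite e addrC.
apply/eqP; rewrite -subr_eq0; apply/eqP/ad_eq0; rewrite -cc'.
by apply: big1 => j _; rewrite (partials_not_inner cc') scale0r.
Qed.

Lemma inner_part_linear (r : R) X X' :
  inner_part (r *: X + X') = r *: inner_part X + inner_part X'.
Proof.
have [c e] := inner_partP X; have [c' e'] := inner_partP X'.
rewrite [in LHS]e [in LHS]e' scalerDr addrACA -ad_linearP scaler_sumr -big_split /=.
under eq_bigr do rewrite scalerA -scalerDl.
exact: inner_part_unique.
Qed.

(** Precomposing [mu] with the projection gives one formula for all directions. *)
Definition translate (mu : gLie tau -> skewker gamma) X (Y : chi A) : chi A :=
  nabla0 X Y + Y *m val (mu (inner_part X)).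

Lemma translateP (mu : {linear gLie tau -> skewker gamma}) :
  is_translate nabla0 mu (translate mu).
Proof.
split; first split.
- move=> r X X' Y; rewrite /translate inner_part_linear linearP.
  rewrite -[val (_ + _)]/(mxrscale r (val (mu (inner_part X))) + val (mu (inner_part X'))).
  rewrite mulmxDr -mulmx_mxrscale (connection_linearl conn0) addrACA.
  by rewrite mxrscaleD.
- move=> r X Y Y'; rewrite /translate (connection_linearr conn0) mulmxDl.
  by rewrite mxrscaleD -mxrscale_mulmx addrACA.
- move=> X a Y; rewrite /translate (connection_leibniz conn0) -scalemxAl scalerDr.
  by rewrite addrA.
(* The two translate clauses apply uniqueness with one component zero: combinations of partial
   derivatives have inner part 0, and [ad a] has inner part [a]. *)
- move=> c Y; have := inner_part_unique c 0; rewrite ad0 addr0 /translate => ->.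
  by rewrite linear0 mulmx0 addr0.
- move=> a Y; rewrite /translate; congr (_ + _ *m val (mu _)).
  have := inner_part_unique (fun=> 0) a.
  by rewrite big1 ?add0r// => j _; rewrite scale0r.
Qed.

(** A connection is additive in its direction, so the two prescribed kinds of directions determine
    it. *)
Lemma translate_unique (mu : {linear gLie tau -> skewker gamma}) nabla :
  is_translate nabla0 mu nabla -> nabla = translate mu.
Proof.
move=> t; apply/funext => X; apply/funext => Y.
have t' := translateP mu; have [c ->] := inner_partP X.
rewrite (connection_addl (translate_connection t)).
rewrite (connection_addl (translate_connection t')).
by rewrite !(translate_pd t, translate_pd t', translate_ad t, translate_ad t').
Qed.

Lemma translate_compatible (mu : {linear gLie tau -> skewker gamma}) :
  metric_compatible gamma (translate mu).
Proof.
move=> X Y Z; rewrite (levi_civita_compatible nabla0_LC) /translate innerDl innerDr.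
rewrite addrACA (inner_skewker gamma (val _)).1 ?addr0//.
exact: valP.
Qed.

Lemma translate_pd1 (mu : {linear gLie tau -> skewker gamma}) j Y :
  translate mu (pd A j) Y = nabla0 (pd A j) Y.
Proof.
have <- : \sum_i (i == j)%:R *: pd A i = pd A j.
  rewrite (bigD1 j)//= big1 => [|i /negbTE ->]; last exact: scale0r.
  by rewrite eqxx scale1r addr0.
exact: translate_pd (translateP mu) _ _.
Qed.

Section Difference.
Variable nabla : starder A -> chi A -> chi A.
Hypothesis conn : is_connection nabla.
Hypothesis tf : torsion_free nabla.
Hypothesis re : real_connection gamma nabla.
Hypothesis comp : metric_compatible gamma nabla.

Definition skew_diff (a : gLie tau) : skewker gamma :=
  SkewKer (connection_diff_skewker conn0 conn (ad a)
    (levi_civita_compatible nabla0_LC) comp).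

Lemma skew_diff_linear : linear skew_diff.
Proof.
move=> r a b; apply: val_inj => /=.
by rewrite ad_linearP connection_diff_linear.
Qed.

HB.instance Definition _ := GRing.isLinear.Build R (gLie tau) (skewker gamma) *:%R
  skew_diff skew_diff_linear.

Lemma skew_diff_translate : is_translate nabla0 skew_diff nabla.
Proof.
split=> // [c Y|a Y]; last exact: connection_diffE.
rewrite (connection_diffE conn0 conn) -[RHS]addr0; congr (_ + _).
suff -> : connection_diff nabla0 nabla (\sum_j c j *: pd A j) = 0 by rewrite mulmx0.
elim/big_ind: _ => [|X X' dX dX'|j _].
- by apply/matrixP => i k; rewrite !mxE !connection0l// !mxE subrr.
- by rewrite -[X]scale1r connection_diff_linear// dX dX' mxrscale0 addr0.
(* Linearity is stated for r X + X', so a lone multiple is taken with X' = 0, whose difference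
   matrix is shown to vanish at the end. *)
rewrite -[_ *: _]addr0 connection_diff_linear//.
rewrite (connection_diff_pd conn0 conn (gamma := gamma))//; try by case: nabla0_LC.
rewrite mxrscale0 add0r.
by apply/matrixP => i k; rewrite !mxE !connection0l// !mxE subrr.
Qed.

End Difference.

End Decomposition.

(** * A nonzero linear map into the kernel *)

Section Nontrivial.
Variables (R : realType) (n : nat) (Theta : 'M[R]_n) (A : nctorus Theta).
Variables (tau : invariant_trace A) (gamma : metric A).
Let S := smooth_alg A.

Lemma gen_skew_subproof k : sgen A k - star (sgen A k) \in gLie_pred tau.
Proof.
apply/andP; split; apply/eqP; first by rewrite starB starK opprB.
rewrite -[val _]/(nct_gen A k - star (nct_gen A k)).
by rewrite traceB trace_star trace_gen conjc0 subrr.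
Qed.

Definition gen_skew k : gLie tau := GLie (gen_skew_subproof k).

(** For nu = i gamma^-1 the two terms nu gamma and gamma nu^* are i and its conjugate, which
    cancel. *)
Lemma inv_metric_skew_subproof :
  map_mx (fun a : S => 'i *: a) (metric_inv gamma) \in skewker_pred gamma.
Proof.
apply/skewkerP; rewrite mxstarZ mxstar_metric_inv.
(* Complex scaling becomes scaling by a ring element, to which the matrix lemmas apply. *)
have E (c : R[i]) (M : 'M[S]_n) : map_mx (fun a : S => c *: a) M = c%:A *: M.
  by apply/matrixP => i j; rewrite !mxE -scalerAl mul1r.
have -> : gamma *m map_mx (fun a : S => 'i^*%C *: a) (metric_inv gamma) =
    map_mx (fun a : S => 'i^*%C *: a) (gamma *m metric_inv gamma).
  apply/matrixP => i j; rewrite !mxE scaler_sumr; apply: eq_bigr => k _.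
  by rewrite !mxE scalerAr.
rewrite !E -scalemxAl metric_mulV metric_mulVr -scalerDl -scalerDl.
by rewrite (_ : 'i + _ = 0) ?scale0r//; apply/eqP; rewrite eq_complex /= addr0 subrr eqxx.
Qed.

Definition inv_metric_skew : skewker gamma := SkewKer inv_metric_skew_subproof.

(** Otherwise gamma^-1 = 0 and hence 1 = 0 in the algebra, which the trace refutes. *)
Lemma inv_metric_skew_neq0 : (0 < n)%N -> inv_metric_skew <> 0.
Proof.
move=> n_gt0 /(congr1 val) /= i0; pose k := Ordinal n_gt0.
have M0 : metric_inv gamma = 0.
  apply/matrixP => i j; have := congr1 (fun M : 'M[S]_n => M i j) i0.
  rewrite !mxE => /eqP; rewrite scaler_eq0 => /orP[|/eqP//].
  by rewrite eq_complex /= oner_eq0 andbF.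
have := congr1 (fun M : 'M[S]_n => M k k) (metric_mulV gamma).
rewrite M0 mulmx0 !mxE eqxx => /(congr1 (fun x : S => tau (val x))).
rewrite trace0 trace1 => /eqP.
by rewrite eq_sym oner_eq0.
Qed.

Definition trace_pairing (b a : gLie tau) : R :=
  complex.Re (tau (star (val (val b : S)) * val (val a : S))).

Lemma trace_pairing_linear b : linear (trace_pairing b : gLie tau -> R^o).
Proof.
move=> r a a'; rewrite /trace_pairing gLie_val_linear.
move: (val a : S) (val a' : S) => s s'.
rewrite -[val (_ + _ : S)]/(r%:C *: val s + val s') mulrDr -scalerAr trace_linear.
rewrite raddfD /=; congr (_ + _).
by case: (tau _) => x y /=; rewrite mul0r subr0.
Qed.

Lemma trace_pairing_gen k : trace_pairing (gen_skew k) (gen_skew k) = 2.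
Proof.
rewrite /trace_pairing.
rewrite -[val (val (gen_skew k) : S)]/(nct_gen A k - star (nct_gen A k)).
rewrite starB starK mulrBl !mulrBr !((nct_rel A).1 k).1 !((nct_rel A).1 k).2.
rewrite !traceB -starM trace_star trace_gen2 conjc0 trace1.
by rewrite subr0 sub0r opprK.
Qed.

Definition rank_one_map b (a : gLie tau) : skewker gamma :=
  trace_pairing b a *: inv_metric_skew.

Lemma rank_one_map_linear b : linear (rank_one_map b).
Proof.
move=> r a a'; rewrite /rank_one_map trace_pairing_linear.
by rewrite scalerDl scalerA.
Qed.

HB.instance Definition _ b := GRing.isLinear.Build R (gLie tau) (skewker gamma) *:%R
  (rank_one_map b) (rank_one_map_linear b).

Lemma nontrivial_hom : (0 < n)%N ->
  exists mu : {linear gLie tau -> skewker gamma}, exists a, mu a <> 0.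
Proof.
move=> n_gt0; pose g := gen_skew (Ordinal n_gt0).
exists (rank_one_map g), g; rewrite /= /rank_one_map trace_pairing_gen => /eqP.
rewrite scaler_eq0 pnatr_eq0 /= => /eqP; exact: inv_metric_skew_neq0.
Qed.

End Nontrivial.

Theorem proposition1 (R : realType) (n : nat) (Theta : 'M[R]_n)
    (A : nctorus Theta) (tau : invariant_trace A) (gamma : metric A)
    (nabla0 : starder A -> chi A -> chi A)
    (n_gt0 : (0 < n)%N)
    (Theta_skew : (Theta^T = - Theta)%R)
    (A_generic : generic_nctorus A)
    (nabla0_LC : is_levi_civita tau gamma nabla0) :
  (forall mu : {linear gLie tau -> skewker gamma},
     exists! nabla, is_translate nabla0 mu nabla) /\
  ([set nabla | is_connection nabla /\ torsion_free nabla /\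
                real_connection gamma nabla /\ metric_compatible gamma nabla] =
   [set nabla | exists mu : {linear gLie tau -> skewker gamma},
                is_translate nabla0 mu nabla])%classic /\
  (exists mu : {linear gLie tau -> skewker gamma}, exists a, mu a <> 0%R).
Proof.
split=> [mu|].
  exists (translate nabla0 A_generic mu); split.
    exact: translateP n_gt0 A_generic nabla0_LC mu.
  by move=> nabla /(translate_unique n_gt0 A_generic nabla0_LC).
split; last exact: nontrivial_hom.
apply/seteqP; split=> nabla /=.
  move=> [conn [tf [re comp]]].
  by exists (skew_diff nabla0_LC conn comp); exact: skew_diff_translate.
(* Conversely, by uniqueness the connection is the explicit translate. Torsion and reality involve
   only partial directions, where it agrees with [nabla0]. *)
move=> [mu t]; split; first exact: translate_connection t.
rewrite (translate_unique n_gt0 A_generic nabla0_LC t).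
split; last split; last exact: translate_compatible.
- by move=> j k; rewrite !translate_pd1//; exact: levi_civita_torsion_free nabla0_LC _ _.
- by move=> j k l; rewrite !translate_pd1//; exact: levi_civita_real nabla0_LC _ _ _.
Qed.
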